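(* Let $t\geq 7$ be an integer and let $h(x;t)=x^4-tx^3-3x^2+tx+1\in\mathbf{Z}[x]$. Then $h(x;t)$ is irreducible over $\mathbf{Q}$. If $\alpha$ is any root of $h(x;t)$, then $\alpha$ is an exceptional unit of $\mathbf{Q}(\alpha)$, $1+\alpha$ is also a unit, and consequently $\alpha^2$ is an exceptional unit. The quartic field $\mathbf{Q}(\alpha)$ contains the quadratic field $\mathbf{Q}(\sqrt{t^2+4})$, and the splitting field of $h(x;t)$ over $\mathbf{Q}$ has Galois group isomorphic to the dihedral group $D_4$ of order $8$. Moreover, $\mathbf{Q}(\alpha)$ is monogenic for infinitely many integers $t$.
   Context: For a number field $F$ with ring of integers $\mathcal{O}_F$, a unit $\lambda\in\mathcal{O}_F^\times$ is called an exceptional unit if $1-\lambda$ is also a unit of $\mathcal{O}_F$. A number field $K$ of degree $n$ is called monogenic if its ring of integers has a power basis, i.e. equals $\mathbf{Z}+\beta\mathbf{Z}+\cdots+\beta^{n-1}\mathbf{Z}$ for some $\beta\in K$. *)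

(* Defs.v *)
From HB Require Import structures.
From mathcomp Require Import all_boot all_order all_algebra all_fingroup.
From mathcomp Require Import all_solvable all_field.
From mathcomp Require Import classical_sets cardinality.

Set Implicit Arguments.
Unset Strict Implicit.
Unset Printing Implicit Defensive.

Import GRing.Theory.
Local Open Scope ring_scope.

(* A number field is represented as a subfield E of a finite extension L of  *)
(* rat, so that Q(alpha) is the library's <<1; alpha>> inside any L that     *)
(* contains alpha.                                                           *)

Definition h (t : int) : {poly int} :=
  'X^4 - t *: 'X^3 - 3 *: 'X^2 + t *: 'X + 1.

Section RingOfIntegers.
Variables (L : fieldExtType rat) (E : {subfield L}).

Definition in_ring_of_integers (x : L) : Prop :=
  x \in E /\ integralOver (intr : int -> L) x.

Definition is_int_unit (x : L) : Prop :=
  in_ring_of_integers x /\ exists2 y, in_ring_of_integers y & x * y = 1.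

Definition is_exceptional_unit (x : L) : Prop :=
  is_int_unit x /\ is_int_unit (1 - x).

(* \dim E is the degree of E over rat, the scalar field of L. *)
Definition is_monogenic : Prop :=
  exists2 beta : L, beta \in E &
    forall x : L, in_ring_of_integers x <->
      exists a : 'I_(\dim E) -> int,
        x = \sum_(i < \dim E) (a i)%:~R * beta ^+ i.

End RingOfIntegers.

(* Main.v *)
(* Put y = alpha - 1/alpha.  Then h(alpha) = alpha^2 (y^2 - t y - 1), so s = 2 y - t is a square root
   of t^2 + 4, and alpha and -1/alpha are the roots of X^2 - y X - 1 over F = Q(s).

   Irreducibility is Gauss's lemma: factors of h have constant and leading coefficients 1 or -1,
   while h(1) = h(-1) = -1.

   Let gamma be a root of the conjugate quadratic X^2 - (t - y) X - 1.  The discriminants y^2 + 4 and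
   (t - y)^2 + 4 have product 4 t^2 + 25.  For t >= 7 neither this number nor its product with
   t^2 + 4 is a square, so gamma is not in Q(alpha) and the splitting field has degree 8.  The
   automorphism fixing alpha and moving gamma, and the one exchanging alpha and gamma, are two
   involutions generating a group of order 8, which is therefore dihedral.

   If t^2 + 4 and 4 t^2 + 25 are squarefree, then the powers of alpha form an integral basis: for an
   integral x = a + b alpha with a, b in F, subtracting the conjugate of x over F and squaring shows
   that b^2 (y^2 + 4) is integral; its norm N(b)^2 (4 t^2 + 25) is an integer, hence so is N(b), and
   then so is (4 t^2 + 25) Tr(b)^2, hence Tr(b); thus b is in Z[y], and so is a.

   Both numbers are squarefree for infinitely many t = 10 k + 7.  Only primes p >= 7 can be bad; p^2
   divides one of the two values for at most 4 (N / p^2 + 1) of the k < N, and only if p <= 32 N.  As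
   the sum of 4 / p^2 over p >= 7 is at most 2/3 and the number of primes up to 32 N is o(N) by
   Chebyshev's estimate from central binomial coefficients, a positive proportion of k survives. *)
Require Import Defs.
From HB Require Import structures.
From mathcomp Require Import all_boot all_order all_algebra all_fingroup.
From mathcomp Require Import all_solvable all_field.
From mathcomp Require Import classical_sets cardinality zify ring lra.
Set Implicit Arguments.
Unset Strict Implicit.
Unset Printing Implicit Defensive.

Import Order.TTheory GRing.Theory Num.Theory.

(** * Squarefree values of two quadratic polynomials *)

Lemma prod_primes_dvdn (s : seq nat) (m : nat) :
  uniq s -> {in s, forall p, prime p && (p %| m)} -> \prod_(p <- s) p %| m.
Proof.
elim: s => [|p s IHs] /=; first by rewrite big_nil dvd1n.
case/andP=> p_s s_uniq Hs; rewrite big_cons.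
have /andP[p_pr p_m] := Hs p (mem_head _ _).
rewrite Gauss_dvd ?p_m ?IHs //; first by move=> q q_s; rewrite Hs ?inE ?q_s ?orbT.
rewrite big_seq; apply: (big_ind (coprime p)) => [|x y|q q_s].
- exact: coprimen1.
- by move=> cx cy; rewrite coprimeMr cx.
have /andP[q_pr _] : prime q && (q %| m) by apply: Hs; rewrite inE q_s orbT.
by rewrite prime_coprime // dvdn_prime2 //; apply: contraNneq p_s => ->.
Qed.

(** * Chebyshev's bound on the number of primes *)

Definition primepi (n : nat) : nat := \sum_(0 <= p < n.+1) prime p.

Lemma prime_dvdn_fact (p n : nat) : prime p -> p %| n`! -> p <= n.
Proof.
move=> p_pr; elim: n => [|n IHn]; first by rewrite fact0 Euclid_dvd1.
by rewrite factS Euclid_dvdM // => /orP[/dvdn_leq -> //|/IHn /leqW].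
Qed.

(* Every prime in ]n, 2n] divides the central binomial coefficient. *)
Lemma primepi_double (n : nat) :
  n ^ (primepi n.*2 - primepi n) <= 2 ^ n.*2.
Proof.
pose s := [seq p <- index_iota n.+1 n.*2.+1 | prime p].
have le_n2 : n <= n.*2 by lia.
have sub_n2 : n.*2 - n = n by lia.
have s_dvd : \prod_(p <- s) p %| 'C(n.*2, n).
  apply: prod_primes_dvdn => [|p]; first by rewrite filter_uniq ?iota_uniq.
  rewrite mem_filter mem_index_iota => /and3P[p_pr ltnp lep].
  rewrite p_pr /=.
  have : p %| (n.*2)`! by rewrite dvdn_fact // prime_gt0.
  rewrite -(bin_fact le_n2) !Euclid_dvdM // sub_n2 => /orP[//|/orP[]] /(prime_dvdn_fact p_pr);
    by rewrite leqNgt ltnp.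
have -> : primepi n.*2 - primepi n = size s.
  rewrite /primepi (big_cat_nat (n := n.+1)) //= addKn size_filter -sum1_count.
  by rewrite [RHS]big_mkcond; apply: eq_bigr => p _; case: prime.
have bin_gt : 0 < 'C(n.*2, n) by rewrite bin_gt0.
apply: leq_trans (leq_trans (dvdn_leq bin_gt s_dvd) _); last first.
  rewrite -[2]/(1 + 1) expnDn (bigD1 (inord n)) //= inordK //.
  by rewrite !exp1n !muln1 leq_addr.
have : {in s, forall p, n <= p} by move=> p; rewrite mem_filter mem_index_iota => /and3P[_ /ltnW].
elim: (s) => [_|p r IHr Hr]; first by rewrite big_nil.
rewrite big_cons /= expnS leq_mul ?Hr ?mem_head // IHr // => q q_r.
by rewrite Hr // inE q_r orbT.
Qed.

(** This is pi(n) = o(n) along powers of 2, without real numbers. Passing from 2 ^ J to 2 ^ J.+1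
    adds d primes with J * d <= 2 ^ J.+1. From J = 2 A on this gives A * d <= 2 ^ J, exactly the
    growth of the right-hand side; [C] absorbs the smaller J. *)
Lemma primepi_pow2 (A : nat) :
  exists C, forall J, A * primepi (2 ^ J) <= C + 2 ^ J.
Proof.
have le_pi m n : m <= n -> primepi m <= primepi n.
  by move=> le_mn; rewrite /primepi [leqRHS](big_cat_nat (n := m.+1)) //= leq_addr.
pose j0 := (2 * A)%N; exists (A * primepi (2 ^ j0)).
elim=> [|J IHJ].
  by rewrite (leq_trans _ (leq_addr _ _)) // leq_mul // le_pi // leq_exp2l.
have [le_j|lt_j] := leqP J.+1 j0.
  by rewrite (leq_trans _ (leq_addr _ _)) // leq_mul // le_pi // leq_exp2l.
have := primepi_double (2 ^ J).
rewrite -expnM leq_exp2l // -mul2n -expnS.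
set d := _ - _ => Jd.
have le2 : 2 * A * d <= 2 ^ J.+1 by rewrite (leq_trans _ Jd) // leq_mul.
have -> : primepi (2 ^ J.+1) = primepi (2 ^ J) + d.
  by rewrite /d subnKC // le_pi // leq_exp2l.
move: le2; rewrite expnS; nia.
Qed.

(** Numbers with the same residue modulo D are separated by their quotients, so k |-> k %/ D is
    injective on P. *)
Lemma count_congruent (P : pred nat) (D N : nat) : 0 < D ->
  (forall k l, P k -> P l -> k = l %[mod D]) ->
  \sum_(0 <= k < N) P k <= (N %/ D).+1.
Proof.
move=> D_gt0 congP; pose s := [seq k <- index_iota 0 N | P k].
have -> : \sum_(0 <= k < N) P k = size [seq k %/ D | k <- s].
  rewrite size_map size_filter -sum1_count [RHS]big_mkcond.
  by apply: eq_bigr => k _; case: (P k).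
rewrite -(size_iota 0 (N %/ D).+1); apply: uniq_leq_size => [|_ /mapP[k k_s ->]].
  rewrite map_inj_in_uniq ?filter_uniq ?iota_uniq // => k l.
  rewrite !mem_filter => /andP[Pk _] /andP[Pl _] eq_kl.
  by rewrite (divn_eq k D) (divn_eq l D) eq_kl (congP k l).
move: k_s; rewrite mem_filter mem_index_iota mem_iota => /and3P[_ _ /ltnW le_k].
by rewrite add0n ltnS leq_div2r.
Qed.

(** The difference of the two values is a (t - u) (t + u). If p divided both t - u and t + u, it
    would divide 2 t, hence t, hence b; so p ^ 2 divides one of the two factors. *)
Lemma quadratic_congruence (a b p t u : nat) :
  prime p -> 2 < p -> ~~ (p %| a) -> ~~ (p %| b) ->
  p ^ 2 %| a * t ^ 2 + b -> p ^ 2 %| a * u ^ 2 + b ->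
  t = u %[mod p ^ 2] \/ p ^ 2 %| t + u.
Proof.
move=> p_pr p_gt2 pa pb; wlog le_ut : t u / u <= t.
  move=> IH dt du; case/orP: (leq_total u t) => [/IH/(_ dt du) //|/IH].
  by case/(_ du dt) => [->|]; [left | rewrite addnC; right].
move=> dt du; have := dvdn_sub dt du.
have -> : (a * t ^ 2 + b - (a * u ^ 2 + b) = a * ((t - u) * (t + u)))%N.
  by rewrite -subn_sqr mulnBr subnDr.
rewrite Gauss_dvdr; last by rewrite coprimeXl // prime_coprime.
have [p_tu|p_tu] := boolP (p %| t - u); last first.
  by rewrite Gauss_dvdr ?coprimeXl ?prime_coprime //; right.
rewrite Gauss_dvdl; first by move=> d; left; apply/eqP; rewrite eqn_mod_dvd.
rewrite coprimeXl // prime_coprime //; apply/negP => p_tu'.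
have := dvdn_add p_tu p_tu'.
rewrite addnCA subnK // addnn -mul2n.
rewrite Euclid_dvdM // => /orP[/(dvdn_leq (isT : 0 < 2))|p_t]; first by rewrite leqNgt p_gt2.
have p_at : p %| a * t ^ 2 by rewrite dvdn_mull // Euclid_dvdX // p_t.
have : p %| a * t ^ 2 + b by apply: dvdn_trans dt; rewrite dvdn_exp.
by rewrite (dvdn_addr _ p_at) (negPf pb).
Qed.

(** Once one such k0 is known, every other k has 10 k + 7 congruent to 10 k0 + 7 or to its opposite
    modulo p ^ 2. As p is prime to 10, this leaves two residue classes of k. *)
Lemma count_quadratic (a b p N : nat) :
  prime p -> 5 < p -> ~~ (p %| a) -> ~~ (p %| b) ->
  \sum_(0 <= k < N) (p ^ 2 %| a * (10 * k + 7) ^ 2 + b) <= 2 * (N %/ p ^ 2).+1.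
Proof.
move=> p_pr p_gt5 pa pb; pose P k := p ^ 2 %| a * (10 * k + 7) ^ 2 + b.
rewrite -[leqLHS]/(\sum_(0 <= k < N) P k).
have p10 : coprime (p ^ 2) 10.
  rewrite coprimeXl // prime_coprime //; apply/negP.
  by rewrite -[10]/(2 * 5)%N Euclid_dvdM // => /orP[] /dvdn_leq; lia.
have q_gt0 : 0 < p ^ 2 by rewrite expn_gt0 prime_gt0.
have cong10 k l : 10 * k + 7 = 10 * l + 7 %[mod p ^ 2] -> k = l %[mod p ^ 2].
  wlog le_lk : k l / l <= k => [IH eq_kl|/eqP].
    by case/orP: (leq_total l k) => [/IH->//|/IH->].
  rewrite eqn_mod_dvd ?leq_add2r ?leq_mul // subnDr -mulnBr Gauss_dvdr // => d.
  by apply/eqP; rewrite eqn_mod_dvd.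
have [/existsP[k0 Pk0]|noP] := boolP [exists k0 : 'I_N, P k0]; last first.
  rewrite big_mkord big1 // => k _; apply/eqP; rewrite eqb0.
  by apply: contra noP => Pk; apply/existsP; exists k.
pose P1 k := P k && (k == k0 %[mod p ^ 2]).
pose P2 k := P k && (p ^ 2 %| 10 * k + 7 + (10 * k0 + 7)).
apply: (@leq_trans (\sum_(0 <= k < N) (P1 k + P2 k))).
  apply: leq_sum => k _; rewrite /P1 /P2; case Pk: (P k) => //=.
  have [/cong10/eqP->//|->] := quadratic_congruence p_pr (ltn_trans (isT : 2 < 5) p_gt5) pa pb
    Pk Pk0.
  by rewrite addn1.
rewrite big_split mul2n -addnn leq_add //; apply: count_congruent => // k l.
  by case/andP=> _ /eqP-> /andP[_ /eqP->].
move=> /andP[_ dk] /andP[_ dl]; apply: cong10; apply/eqP.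
by rewrite -(eqn_modDr (10 * k0 + 7)) (eqP dk) (eqP dl).
Qed.

(* Telescoping: [1 / p ^ 2 <= 1 / (p - 1) - 1 / p]. *)
Lemma sum_divn_sqr (N B : nat) : 6 * (\sum_(7 <= p < B) N %/ p ^ 2) <= N.
Proof.
have [le_B7|/ltnW/subnK<-] := leqP B 7; first by rewrite big_geq.
set n := B - 7.
have main : ((\sum_(7 <= p < n + 7) N %/ p ^ 2)%N%:R <=
             N%:R * (6%:R^-1 - (n + 6)%N%:R^-1) :> rat)%R.
  elim: n => [|n IHn]; first by rewrite big_geq //= add0n subrr mulr0.
  rewrite addSn big_nat_recr ?leq_addl //= natrD.
  apply: le_trans (lerD IHn _ : _ <= _ + N%:R * ((n + 6)%N%:R^-1 - (n.+1 + 6)%N%:R^-1))%R _.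
    have -> : (((n + 6)%N%:R^-1 - (n.+1 + 6)%N%:R^-1) =
               ((n + 6) * (n + 7))%N%:R^-1 :> rat)%R.
      rewrite addSnnS natrM !natrD.
      have := ler0n rat n; move: (n%:R)%R => x x_ge0.
      by field; apply/andP; split; lra.
    rewrite ler_pdivlMr ?ltr0n; last by rewrite muln_gt0 !addnS.
    rewrite -natrM ler_nat (leq_trans _ (leq_trunc_div N ((n + 7) ^ 2))) // leq_mul //.
    by rewrite leq_mul // leq_add2l.
  by rewrite -mulrDr addrA subrK.
have := mulr_ge0 (ler0n rat N) (_ : 0 <= (n + 6)%N%:R^-1)%R.
rewrite invr_ge0 ler0n => /(_ isT) Na; rewrite -(ler_nat rat) natrM.
by move: main; rewrite mulrBr; lra.
Qed.

Definition square_free (n : nat) : Prop := forall p, prime p -> ~~ (p ^ 2 %| n).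

(** The reason for the progression 10 k + 7: it is 1 modulo 2 and 2 modulo 5, which keeps 2 and 5
    out of both values. Modulo 3 both values are t ^ 2 + 1, which never vanishes. *)
Lemma small_prime_ndvd (k p : nat) : prime p -> p < 7 ->
  ~~ (p %| (10 * k + 7) ^ 2 + 4) /\ ~~ (p %| 4 * (10 * k + 7) ^ 2 + 25).
Proof.
move=> p_pr; have t2 : (10 * k + 7) %% 2 = 1.
  by rewrite (_ : _ + _ = (5 * k + 3) * 2 + 1)%N ?modnMDl //; lia.
have t5 : (10 * k + 7) %% 5 = 2.
  by rewrite (_ : _ + _ = (2 * k + 1) * 5 + 2)%N ?modnMDl //; lia.
move: p_pr t2 t5; move: (10 * k + 7) => t.
case: p => [|[|[|[|[|[|[|//]]]]]]] //= _ t2 t5 _; rewrite /dvdn.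
- by split; [rewrite -modnDml -modnXm t2|rewrite -modnDml -modnMmr -modnXm t2].
- have t3 : t %% 3 < 3 by rewrite ltn_mod.
  split; [rewrite -modnDml -modnXm|rewrite -modnDml -modnMmr -modnXm];
    by case: (t %% 3) t3 => [|[|[|]]].
by split; [rewrite -modnDml -modnXm t5|rewrite -modnDml -modnMmr -modnXm t5].
Qed.

Lemma square_free_values (K : nat) : exists2 k, K <= k &
  square_free ((10 * k + 7) ^ 2 + 4) /\ square_free (4 * (10 * k + 7) ^ 2 + 25).
Proof.
(* As 768 = 24 * 32, 4 pi(32 N) is at most N / 6 + C / 192. Were every k in [K, N[ bad, N - K <= 2 N
   / 3 + N / 6 + C / 192 would give N <= 6 K + C, which the choice of [N] excludes. [N] is a power
   of 2 so that 32 N is one too. *)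
have [C piC] := primepi_pow2 768.
pose N := 2 ^ (6 * K + C); pose B := (32 * N).+1.
have N_gt0 : 0 < N by rewrite expn_gt0.
pose F (p k : nat) : bool := p ^ 2 %| 1 * (10 * k + 7) ^ 2 + 4.
pose G (p k : nat) : bool := p ^ 2 %| 4 * (10 * k + 7) ^ 2 + 25.
have [/hasP[k]|/hasPn bad] := boolP (has (fun k =>
  all (fun p => prime p ==> ~~ F p k && ~~ G p k) (iota 7 (B - 7))) (index_iota K N)).
  rewrite mem_index_iota => /andP[leKk ltkN] /allP good; exists k => //.
  suff sqf p : prime p -> ~~ F p k /\ ~~ G p k.
    by split=> p /sqf[]; rewrite /F /G ?mul1n.
  move=> p_pr; have [lt_p7|le_7p] := ltnP p 7.
    have [f g] := small_prime_ndvd k p_pr lt_p7.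
    by split; rewrite /F /G ?mul1n; [apply: contra f|apply: contra g];
      apply: dvdn_trans; rewrite dvdn_exp.
  have [lt_pB|le_Bp] := ltnP p B.
    apply/andP; have := good p; rewrite p_pr; apply.
    by rewrite mem_iota le_7p subnKC // (leq_trans le_7p) // ltnW.
  (* Primes above 32 N are harmless: 10 k + 7 < 10 N, so both values are below p ^ 2. *)
  have p2_big : 4 * (10 * k + 7) ^ 2 + 25 < p ^ 2.
    apply: leq_trans (_ : (32 * N + 1) ^ 2 <= _); last by rewrite leq_exp2r // addn1.
    apply: leq_ltn_trans (_ : 4 * (10 * N) ^ 2 + 25 < _).
      by rewrite leq_add2r leq_mul2l leq_exp2r //; lia.
    by move: N_gt0; move: (N) => M; clear; nia.
  split; first rewrite /F mul1n gtnNdvd ?(leq_ltn_trans _ p2_big) ?addn_gt0 ?orbT //; last first.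
    by rewrite /G gtnNdvd ?addn_gt0 ?orbT.
  by rewrite leq_add // leq_pmull.
exfalso.
have {}bad k : K <= k < N -> 1 <= \sum_(7 <= p < B) prime p * (F p k + G p k).
  rewrite -mem_index_iota => /bad/allPn[p p_in]; rewrite negb_imply => /andP[p_pr].
  rewrite (bigD1_seq p) ?iota_uniq //= p_pr mul1n.
  by case: (F p k); case: (G p k) => //= _; rewrite -addnA.
(* The pairs (k, p) with p ^ 2 dividing a value are counted in both orders: at least one for each k,
   at most 4 (N / p ^ 2 + 1) for each prime p. *)
have : \sum_(K <= k < N) 1 <= \sum_(7 <= p < B) 4 * (N %/ p ^ 2 + prime p).
  apply: (@leq_trans (\sum_(K <= k < N) \sum_(7 <= p < B) prime p * (F p k + G p k))).
    by rewrite !big_nat; apply: leq_sum => k /bad.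
  rewrite exchange_big !big_nat; apply: leq_sum => p /andP[le_7p _].
  case p_pr: (prime p); last by rewrite big1.
  have p_ndvd m : 0 < m -> m < 7 -> ~~ (p %| m).
    by move=> m_gt0 lt_m; apply/negP => /(dvdn_leq m_gt0); rewrite leqNgt (leq_trans lt_m).
  have p_ndvd25 : ~~ (p %| 25) by rewrite -[25]/(5 ^ 2) Euclid_dvdX // andbT p_ndvd.
  have le_KN (P : pred nat) : \sum_(K <= k < N) P k <= \sum_(0 <= k < N) P k.
    have [/ltnW leKN|leNK] := ltnP K N; last by rewrite big_geq.
    by rewrite [leqRHS](big_cat_nat (n := K)) //= leq_addl.
  under eq_bigr do rewrite mul1n.
  rewrite big_split /= (leq_trans (leq_add (le_KN _) (le_KN _))) //.
  apply: leq_trans (leq_add (count_quadratic N p_pr _ _ _) (count_quadratic N p_pr _ _ _)) _;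
    rewrite ?p_ndvd25 ?p_ndvd ?(leq_trans _ le_7p) //.
  by move: (N %/ _) => x; lia.
rewrite sum_nat_const_nat muln1 -big_distrr big_split /=.
have := sum_divn_sqr N B.
have : \sum_(7 <= p < B) prime p <= primepi (32 * N).
  by rewrite /primepi -/B [leqRHS](big_cat_nat (n := 7)) ?leq_addl // /B; move: N_gt0; lia.
have := piC (5 + (6 * K + C)); rewrite expnD -/N -[2 ^ 5]/32.
have : 6 * K + C < N by rewrite ltn_expl.
move: (N) (primepi _) (\sum_(7 <= p < B) prime p) (\sum_(7 <= p < B) N %/ p ^ 2).
by move=> M x y z; clear; lia.
Qed.

Local Open Scope ring_scope.

(** * Rational and algebraic integers *)

(** The squared denominator of r is coprime to the squared numerator, so it divides d; a prime
    factor of the denominator would then contradict square-freeness. *)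
Lemma square_free_rat_int (d : nat) (r : rat) :
  square_free d -> d%:R * r ^+ 2 \is a Num.int -> r \is a Num.int.
Proof.
move=> d_sqf /intrP[z dr2].
have den_nz : (denq r)%:~R != 0 :> rat by rewrite intr_eq0 denq_neq0.
have eq_int : d%:Z * numq r ^+ 2 = z * denq r ^+ 2.
  apply: (@intr_inj rat); rewrite !rmorphM /= -dr2 -{3}(divq_num_den r).
  by field.
have eq_nat : (d * `|numq r| ^ 2 = `|z| * `|denq r| ^ 2)%N.
  by have := congr1 absz eq_int; rewrite !expr2 !abszM !mulnn.
have den_dvd : (`|denq r| ^ 2 %| d)%N.
  have := dvdn_mull `|z| (dvdnn (`|denq r| ^ 2)); rewrite -eq_nat Gauss_dvdl //.
  by rewrite coprime_sym coprimeXl ?coprimeXr // coprime_num_den.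
suff den1 : `|denq r|%N = 1%N.
  by rewrite Qint_def; apply/eqP; move: den1 (denq_gt0 r); lia.
apply/eqP; rewrite eqn_leq absz_gt0 denq_neq0 andbT leqNgt.
apply/negP => /pdivP[p p_pr p_den]; have /negP[] := d_sqf p p_pr.
by apply: dvdn_trans den_dvd; rewrite dvdn_exp2r.
Qed.

Lemma sqr_rat_int (r : rat) (n : int) :
  r ^+ 2 = n%:~R -> exists m : int, n = m ^+ 2.
Proof.
move=> r2; have /intrP[m r_m] : r \is a Num.int.
  apply: (@square_free_rat_int 1); last by rewrite mul1r r2 intr_int.
  by move=> p /prime_gt1 p_gt1; rewrite gtnNdvd // (ltn_trans p_gt1) // -{1}(expn1 p) ltn_exp2l.
by exists m; apply: (@intr_inj rat); rewrite -r2 r_m rmorphXn.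
Qed.

Section IntegralElements.
Variable L : fieldExtType rat.
Local Notation intL := (intr : int -> L).
Local Notation integral := (integralOver intL).

Lemma integral_int (n : int) : integral n%:~R.
Proof. exact: (integral_id (intr : {rmorphism int -> L})). Qed.

Lemma integralD (u v : L) : integral u -> integral v -> integral (u + v).
Proof. exact: (@integral_add _ _ (intr : {rmorphism int -> L})). Qed.

Lemma integralB (u v : L) : integral u -> integral v -> integral (u - v).
Proof. exact: (@integral_sub _ _ (intr : {rmorphism int -> L})). Qed.

Lemma integralM (u v : L) : integral u -> integral v -> integral (u * v).
Proof. exact: (@integral_mul _ _ (intr : {rmorphism int -> L})). Qed.

Lemma map_poly_intr_alg (p : {poly int}) :
  map_poly intL p = map_poly (in_alg L) (map_poly (intr : int -> rat) p).
Proof.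
rewrite -map_poly_comp; apply: eq_map_poly => n /=.
by rewrite -[RHS]/(in_alg L n%:~R) rmorph_int.
Qed.

(** By Gauss's lemma a scalar multiple of X - u is an integer factor of a monic integer polynomial.
    Its leading coefficient is therefore 1 or -1, and u is an integer. *)
Lemma integral_rat (u : rat) : integral (in_alg L u) -> u \is a Num.int.
Proof.
case=> P P_mon; rewrite map_poly_intr_alg fmorph_root -dvdp_XsubCl.
case/dvdpP_rat_int => q [a a_nz Xu] [r P_qr].
have lead1 : lead_coef q * lead_coef r = 1.
  by rewrite -lead_coefM -P_qr (eqP P_mon).
have := congr1 (fun p : {poly rat} => p`_1) Xu; have := congr1 (fun p : {poly rat} => p`_0) Xu.
have sz_q : size q = 2%N.
  have := congr1 (fun p : {poly rat} => size p) Xu.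
  by rewrite size_XsubC size_scale // size_rat_int_poly.
move: lead1; rewrite /lead_coef sz_q /= !coefZ !coef_map !coefB !coefX !coefC /=.
move: (r`_ _) (q`_0) (q`_1) => r1 q0 q1 lead1; rewrite sub0r subr0 => u_eq a_eq.
have key (v b m n l : rat) : n * l = 1 -> - v = b * m -> 1 = b * n -> v = - (m * l).
  move=> nl v_eq bn; have -> : l = b by rewrite -[l]mul1r bn -mulrA nl mulr1.
  by rewrite mulrC -v_eq opprK.
have {}lead1 : q1%:~R * r1%:~R = 1 :> rat by rewrite -intrM lead1.
by rewrite (key _ _ _ _ _ lead1 u_eq a_eq) -intrM -rmorphN intr_int.
Qed.

Lemma conj_root (p q : {poly rat}) (a b : L) : irreducible_poly p ->
  root (map_poly (in_alg L) p) a -> root (map_poly (in_alg L) p) b ->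
  root (map_poly (in_alg L) q) a -> root (map_poly (in_alg L) q) b.
Proof.
move=> p_irr pa pb qa; have [/dvdpP[r ->]|] := boolP (p %| q).
  by rewrite rmorphM rootM /= pb orbT.
rewrite -irreducible_poly_coprime // -(coprimep_map (in_alg L)).
by move=> /coprimep_root/(_ pa); rewrite (eqP qa) eqxx.
Qed.

(** If a monic integer P kills c(a), then P composed with c vanishes at a, hence at its conjugate b:
    the same P witnesses that c(b) is integral. *)
Lemma conj_integral (p c : {poly rat}) (a b : L) : irreducible_poly p ->
  root (map_poly (in_alg L) p) a -> root (map_poly (in_alg L) p) b ->
  integral (map_poly (in_alg L) c).[a] -> integral (map_poly (in_alg L) c).[b].
Proof.
move=> p_irr pa pb [P P_mon Pc]; exists P => //.
move: Pc; rewrite map_poly_intr_alg !/(root _ _) -!horner_comp -!map_comp_poly.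
exact: conj_root p_irr pa pb.
Qed.
End IntegralElements.

(** * The polynomial h *)

Lemma map_h (R : comNzRingType) (t : int) : map_poly (intr : int -> R) (h t) =
  'X^4 - t%:~R *: 'X^3 - 3 *: 'X^2 + t%:~R *: 'X + 1.
Proof. by rewrite /h !(rmorphD, rmorphN) /= !map_polyZ !map_polyXn map_polyX rmorph1. Qed.

Lemma horner_h (R : comNzRingType) (t : int) (x : R) :
  (map_poly (intr : int -> R) (h t)).[x] =
  x ^+ 4 - t%:~R * x ^+ 3 - 3 * x ^+ 2 + t%:~R * x + 1.
Proof. by rewrite map_h !hornerE. Qed.

Lemma size_monic_h (t : int) : size (h t) = 5%N /\ h t \is monic.
Proof.
have lt_size : (size (- (t *: 'X^3) - 3 *: 'X^2 + t *: 'X + 1)%R < size ('X^4 : {poly int}))%N.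
  rewrite size_polyXn ltnS; have sz (c : int) (n : nat) : (n <= 3)%N -> (size (c *: 'X^n)%R <= 4)%N.
    by move=> le_n; rewrite (leq_trans (size_scale_leq _ _)) // size_polyXn.
  have szD (p q : {poly int}) : (size p <= 4)%N -> (size q <= 4)%N -> (size (p + q)%R <= 4)%N.
    by move=> szp szq; rewrite (leq_trans (size_polyD _ _)) // geq_max szp.
  by rewrite !szD ?size_polyN ?sz ?size_poly1 // -(expr1 'X) sz.
have -> : h t = 'X^4 + (- (t *: 'X^3) - 3 *: 'X^2 + t *: 'X + 1) by rewrite /h !addrA.
by rewrite monicE lead_coefDl // size_polyDl // lead_coefXn size_polyXn.
Qed.

Lemma mulz_eq1 (a b : int) : a * b = 1 -> a = 1 \/ a = -1.
Proof. by rewrite mulrC => /intUnitRing.unitzPl; rewrite qualifE /= => /orP[] /eqP;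
  [left|right]. Qed.

Lemma irreducible_h (t : int) : t != 0 ->
  irreducible_poly (map_poly (intr : int -> rat) (h t)).
Proof.
move=> t_nz; have [size_h monic_h] := size_monic_h t.
have h_nz : h t != 0 by rewrite monic_neq0.
split=> [|p p_n1 /dvdpP_rat_int[q [a a_nz def_p] [r def_h]]].
  by rewrite size_rat_int_poly size_h.
have q_nz : q != 0 by apply: contraNneq h_nz => q0; rewrite def_h q0 mul0r.
have r_nz : r != 0 by apply: contraNneq h_nz => r0; rewrite def_h r0 mulr0.
have size_qr : (size q + size r = 6)%N.
  have := size_h; rewrite def_h size_mul //.
  by case: (size q) (size_poly_gt0 q) => [|m _]; [rewrite q_nz | rewrite addSn /= => ->].
have {p_n1} size_q : size q != 1%N by move: p_n1; rewrite def_p size_scale ?size_rat_int_poly.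
have valh x : q.[x] * r.[x] = x ^+ 4 - t * x ^+ 3 - 3 * x ^+ 2 + t * x + 1.
  by rewrite -hornerM -def_h /h !hornerE.
have v0 := valh 0; have v1 := valh 1; have vN1 := valh (-1).
(* A linear factor has both coefficients equal to 1 or -1, so it vanishes at 1 or at -1, where h
   takes the value -1. *)
have small (f g : {poly int}) : size f = 2%N -> f.[0] * g.[0] = 1 ->
    f.[1] * g.[1] = - 1 -> f.[-1] * g.[-1] = - 1 -> lead_coef f * lead_coef g = 1 -> False.
  move=> sz_f; rewrite ![f.[_]](@horner_coef_wide _ 2) ?sz_f // lead_coefE sz_f.
  rewrite !big_ord_recl !big_ord0 /=.
  rewrite !(expr0, expr1, mulr1, mulr0, addr0, mulrN1).
  move=> /mulz_eq1 u.  move=> v w /mulz_eq1 l; move: v w.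
  by case: u => ->; case: l => ->; rewrite ?subrr ?addNr ?addrN ?mul0r; lia.
have lead1 : lead_coef q * lead_coef r = 1 by rewrite -lead_coefM -def_h (eqP monic_h).
have sz_r1 : size r = 1%N \/ size r = 2%N \/ size r = 3%N \/ size q = 2%N.
  move: size_q size_qr (size_poly_gt0 q) (size_poly_gt0 r); rewrite q_nz r_nz.
  by move: (size q) (size r) => m n; lia.
case: sz_r1 => [sz_r|[sz_r|[sz_r|sz_q]]].
- rewrite def_p (eqp_trans (eqp_scale _ a_nz)) // -dvdp_size_eqp; last first.
    by rewrite dvdp_rat_int def_h dvdp_mulIl.
  by move: size_qr; rewrite !size_rat_int_poly size_h sz_r addn1 => -[->].
- exfalso; apply: (small r q sz_r); rewrite 1?mulrC ?v0 ?v1 ?vN1 //; lia.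
(* Two quadratic factors have the same unit constant term a0 and the same unit leading coefficient
   a2. Then a0 (a1 + b1) = t = - a2 (a1 + b1) forces a2 = - a0, the middle coefficient gives a1 b1 =
   -1, so a1 + b1 = 0 and t = 0. *)
- exfalso; have sz_q : size q = 3%N by move: size_qr; rewrite sz_r !addnS addn0 => -[].
  have cf i : (q * r)`_i = (h t)`_i by rewrite -def_h.
  have [c1 c2] := (cf 1%N, cf 2%N); have c3 := cf 3%N.
  move: c1 c2 c3 v0 lead1; rewrite !coefM !big_ord_recl !big_ord0 /= /h.
  rewrite !(coefD, coefN, coefZ, coefXn, coefX, coef1) /=.
  rewrite !lead_coefE sz_q sz_r /= !horner_coef0 /bump /=.
  rewrite (@nth_default _ _ q 3) ?sz_q // (@nth_default _ _ r 3) ?sz_r //.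
  move: (q`_0) (q`_1) (q`_2) (r`_0) (r`_1) (r`_2) => a0 a1 a2 b0 b1 b2.
  move=> c1 c2 c3 v l.

  have {}v : a0 * b0 = 1 by rewrite v; lia.
  have [l' v'] := (mulz_eq1 l, mulz_eq1 v).
  have b0_a0 : b0 = a0 by case: v' v => ->; lia.
  have b2_a2 : b2 = a2 by case: l' l => ->; lia.
  move: c1 c2 c3; rewrite {}b0_a0 {}b2_a2 => c1 c2 c3.
  have {}c2 : a1 * - b1 = 1.
    by move: t_nz c1 c2 c3; case: l' => ->; case: v' => ->; lia.
  have a1_pm := mulz_eq1 c2.
  have a1_b1 : a1 = - b1 by case: a1_pm c2 => ->; [rewrite mul1r => ->|rewrite mulN1r opprK => ->].
  by move: t_nz c1; rewrite a1_b1; case: v' => ->; lia.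
- exfalso; apply: (small q r sz_q); rewrite ?v0 ?v1 ?vN1 //; lia.
Qed.

Lemma between_squares (a n m : int) :
  0 <= a -> a ^+ 2 < n -> n < (a + 1) ^+ 2 -> n <> m ^+ 2.
Proof.
move=> a_ge0 lt_an lt_na; wlog m_ge0 : m / 0 <= m => [IH|n_m].
  by case: (lerP 0 m) => [/IH//|m_lt0]; rewrite -sqrrN; apply: IH; lia.
move: lt_an lt_na; rewrite n_m !ltr_pXn2r ?nnegrE //; lia.
Qed.

Lemma disc2_nonsquare (t m : int) : 7 <= t -> t ^+ 2 + 4 <> m ^+ 2.
Proof. by move=> t7; apply: (@between_squares t); nia. Qed.

(** The value lies strictly between (2 t) ^ 2 and (2 t + 1) ^ 2. The upper bound amounts to 4 t >
    24, and at t = 6 the value is 13 ^ 2. *)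
Lemma disc4_nonsquare (t m : int) : 7 <= t -> 4 * t ^+ 2 + 25 <> m ^+ 2.
Proof. by move=> t7; apply: (@between_squares (2 * t)); nia. Qed.

Lemma disc_mul_nonsquare (t m : int) : 7 <= t ->
  (4 * t ^+ 2 + 25) * (t ^+ 2 + 4) <> m ^+ 2.
Proof.
move=> t7; have t2_ge0 : 0 <= t ^+ 2 by rewrite sqr_ge0.
have t2_gt0 : 0 < t ^+ 2 by nia.
(* The product equals (2 t ^ 2 + 10) ^ 2 + t ^ 2. *)
by apply: (@between_squares (2 * t ^+ 2 + 10)); nia.
Qed.

Lemma natr_fieldExt_neq0 (L : fieldExtType rat) (n : nat) : n.+1%:R != 0 :> L.
Proof. by rewrite -(rmorph_nat (in_alg L)) fmorph_eq0 pnatr_eq0. Qed.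

(** * Closure properties of integers and units of a number field *)

Section RingOfIntegersTheory.
Variables (L : fieldExtType rat) (E : {subfield L}).
Local Notation OE := (in_ring_of_integers E).

Lemma ring_int (n : int) : OE n%:~R.
Proof. by split; [rewrite rpred_int | apply: integral_int]. Qed.

Lemma ring_add x y : OE x -> OE y -> OE (x + y).
Proof.
case=> Ex intx [Ey inty]; split; first by rewrite rpredD.
exact: integralD.
Qed.

Lemma ring_mul x y : OE x -> OE y -> OE (x * y).
Proof.
case=> Ex intx [Ey inty]; split; first by rewrite rpredM.
exact: integralM.
Qed.

Lemma ring_cubic x (a b c d : int) : OE x ->
  OE (a%:~R + b%:~R * x + c%:~R * x ^+ 2 + d%:~R * x ^+ 3).
Proof.
move=> Ox; have := (ring_int, ring_add, ring_mul) => -[[O1 OD] OM].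
by do 3 ?[apply: (OD)]; do ?[apply: (OM)].
Qed.

Lemma unit_mul x y : is_int_unit E x -> is_int_unit E y -> is_int_unit E (x * y).
Proof.
case=> [Ox [x' Ox' xx']] [Oy [y' Oy' yy']]; split; first exact: ring_mul.
by exists (x' * y'); [exact: ring_mul | rewrite mulrACA xx' yy' mulr1].
Qed.
End RingOfIntegersTheory.

(** * Degrees of simple extensions *)

Section Degrees.
Variable L : fieldExtType rat.

Lemma dim_adjoin_irreducible (p : {poly rat}) (a : L) : irreducible_poly p ->
  root (map_poly (in_alg L) p) a -> \dim <<1; a>>%VS = (size p).-1.
Proof.
move=> p_irr pa; rewrite dim_Fadjoin dimv1 muln1 -[LHS]/(adjoin_degree _ _).+1.-1 -size_minPoly.
have /polyOver1P[m m_eq] := minPolyOver 1 a.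
have : minPoly 1 a %| map_poly (in_alg L) p by apply: minPoly_dvdp; rewrite ?alg_polyOver.
rewrite m_eq dvdp_map => m_p; rewrite size_map_poly.
rewrite (eqp_size (apply_irredp p_irr _ m_p)) //.
by rewrite -(size_map_poly (in_alg L)) -m_eq size_minPoly.
Qed.

Lemma adjoin_degree_quadratic (K : {subfield L}) (a b c : L) :
  b \in K -> c \in K -> a ^+ 2 = b * a + c ->
  (adjoin_degree K a <= 2)%N /\ (a \notin K -> adjoin_degree K a = 2).
Proof.
move=> Kb Kc a_eq; suff le2 : (adjoin_degree K a <= 2)%N.
  split=> // Ka; apply/eqP; rewrite eqn_leq le2 /=.
  by rewrite ltn_neqAle eq_sym adjoin_deg_eq1 Ka.
pose p := 'X^2 - (b *: 'X + c%:P).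
have sz_p : size p = 3%N.
  rewrite size_polyDl ?size_polyXn // size_polyN (leq_ltn_trans (size_polyD _ _)) //.
  rewrite gtn_max (leq_ltn_trans (size_scale_leq _ _)) ?size_polyX //.
  by rewrite (leq_ltn_trans (size_polyC_leq1 _)).
rewrite -ltnS -size_minPoly -sz_p dvdp_leq -?size_poly_gt0 ?sz_p // minPoly_dvdp //.
  by rewrite rpredB ?rpredD ?polyOverZ ?polyOverXn ?polyOverX ?polyOverC.
by rewrite /root !hornerE a_eq subrr.
Qed.

(* If [z = u + v w] with [u], [v] in [K], then [2 u v w = z^2 - u^2 - v^2 w^2] is in [K]. *)
Lemma sqrt_in_quadratic (K : {subfield L}) (w z : L) : w ^+ 2 \in K ->
  z ^+ 2 \in K -> z \in <<K; w>>%VS -> z \in K \/ z * w \in K.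
Proof.
move=> Kw2 Kz2 Kw_z; have [w_K|w_K] := boolP (w \in K).
  by left; rewrite -(Fadjoin_idP w_K).
have w_eq : w ^+ 2 = 0 * w + w ^+ 2 by rewrite mul0r add0r.
have [deg2 _] := adjoin_degree_quadratic (rpred0 K) Kw2 w_eq.
have := Fadjoin_poly_eq Kw_z; set p := Fadjoin_poly K w z => pw.
have Kp := Fadjoin_polyOver K w z; rewrite -/p in Kp.
have sz_p : (size p <= 2)%N by apply: leq_trans (size_Fadjoin_poly _ _ _) deg2.
have [/polyOverP Kpi] := (Kp); move: (Kpi 0%N) (Kpi 1%N) pw.
rewrite (horner_coef_wide _ sz_p) !big_ord_recl big_ord0 /= expr0 mulr1 addr0 expr1.
move: (p`_0) (p`_1) => u v Ku Kv z_eq.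
have [v0|v_nz] := eqVneq v 0; first by left; rewrite -z_eq v0 mul0r addr0.
have [u0|u_nz] := eqVneq u 0.
  by right; rewrite -z_eq u0 add0r -mulrA -expr2 rpredM.
case/negP: w_K; have -> : w = (z ^+ 2 - u ^+ 2 - v ^+ 2 * w ^+ 2) / (2 * u * v).
  by rewrite -z_eq; field; rewrite v_nz u_nz natr_fieldExt_neq0.
apply: rpred_div; last by rewrite !rpredM ?rpred_nat.
exact: rpredB (rpredB Kz2 (rpredX 2 Ku)) (rpredM (rpredX 2 Kv) Kw2).
Qed.
End Degrees.

Lemma sqr_alg_nonsquare (L : fieldExtType rat) (n : int) (z : L) :
  (forall m, n <> m ^+ 2) -> z ^+ 2 = n%:~R -> z \notin 1%VS.
Proof.
move=> n_nonsq z2; apply/negP => /vlineP[r z_r].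
have /sqr_rat_int[m] : r ^+ 2 = n%:~R.
  by apply: (fmorph_inj (in_alg L)); rewrite rmorphXn rmorph_int /= -z_r.
exact: n_nonsq.
Qed.

(** * The units and the quadratic subfield *)

Section RootOfH.
Variables (t : int) (L : fieldExtType rat) (alpha : L).
Hypothesis t_ge7 : 7 <= t.
Hypothesis h_alpha : root (map_poly (intr : int -> L) (h t)) alpha.
Local Notation T := (t%:~R : L).
Local Notation K := <<1; alpha>>%AS.

Lemma t_neq0 : t != 0. Proof. by apply: contraTneq t_ge7 => ->. Qed.

Lemma alpha_eq : alpha ^+ 4 - T * alpha ^+ 3 - 3 * alpha ^+ 2 + T * alpha + 1 = 0.
Proof. by have /eqP := h_alpha; rewrite horner_h. Qed.

Lemma alpha_neq0 : alpha != 0.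
Proof.
apply/eqP => a0; have := alpha_eq; rewrite a0 !expr0n /= !mulr0 !subr0 !add0r.
by move/eqP; rewrite oner_eq0.
Qed.

Lemma ring_alpha : in_ring_of_integers K alpha.
Proof.
split; first exact: memv_adjoin.
by exists (h t) => //; case: (size_monic_h t).
Qed.

(** The inverses here and in the next two lemmas have one source: h(e) is 1 or -1 for e = 0, 1, -1,
    so the quotient (h(X) - h(e)) / (X - e), taken at alpha, is the inverse of alpha - e up to
    sign. *)
Lemma unit_alpha : is_int_unit K alpha.
Proof.
split; first exact: ring_alpha.
exists ((- t)%:~R + 3%:~R * alpha + t%:~R * alpha ^+ 2 + (-1)%:~R * alpha ^+ 3).
  exact/ring_cubic/ring_alpha.
by rewrite -[RHS]subr0 -alpha_eq; ring.
Qed.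

Lemma unit_alpha_sub1 : is_int_unit K (1 - alpha).
Proof.
have := ring_cubic 1 (-1) 0 0 ring_alpha; rewrite !mul0r !addr0 mulN1r => O1a.
split=> //; exists (2%:~R + (2 + t)%:~R * alpha + (t - 1)%:~R * alpha ^+ 2 + (-1)%:~R * alpha ^+ 3).
  exact/ring_cubic/ring_alpha.
by rewrite -[RHS]addr0 -alpha_eq; ring.
Qed.

Lemma unit_alpha_add1 : is_int_unit K (1 + alpha).
Proof.
have := ring_cubic 1 1 0 0 ring_alpha; rewrite !mul0r !addr0 mul1r => O1a.
split=> //; exists (2%:~R + (t - 2)%:~R * alpha + (- (1 + t))%:~R * alpha ^+ 2 + 1%:~R * alpha ^+ 3).
  exact/ring_cubic/ring_alpha.
by rewrite -[RHS]addr0 -alpha_eq; ring.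
Qed.

Lemma exceptional_alpha : is_exceptional_unit K alpha.
Proof. by split; [apply: unit_alpha | apply: unit_alpha_sub1]. Qed.

Lemma exceptional_alpha_sqr : is_exceptional_unit K (alpha ^+ 2).
Proof.
split; first by apply: unit_mul; apply: unit_alpha.
rewrite (_ : 1 - _ = (1 - alpha) * (1 + alpha)); last by ring.
by apply: unit_mul; [apply: unit_alpha_sub1 | apply: unit_alpha_add1].
Qed.

Lemma dim_alpha : \dim K = 4%N.
Proof.
rewrite (@dim_adjoin_irreducible _ (map_poly intr (h t))) -?map_poly_intr_alg //.
  by rewrite size_rat_int_poly (proj1 (size_monic_h t)).
exact/irreducible_h/t_neq0.
Qed.

(* The trace of [alpha] over the quadratic subfield, where its conjugate is [- alpha^-1]. *)
Definition trace_alpha := alpha - alpha^-1.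
Local Notation y := trace_alpha.

Lemma trace_alpha_eq : y ^+ 2 = T * y + 1.
Proof.
apply/eqP; rewrite -subr_eq0 /y; apply/eqP; have a_nz := alpha_neq0.
transitivity ((alpha ^+ 4 - T * alpha ^+ 3 - 3 * alpha ^+ 2 + T * alpha + 1) / alpha ^+ 2).
  by field.
by rewrite alpha_eq mul0r.
Qed.

Definition sqrt_disc := 2 * y - T.

Lemma sqrt_disc_sqr : sqrt_disc ^+ 2 = (t ^+ 2 + 4)%:~R.
Proof.
rewrite /sqrt_disc (_ : _ ^+ 2 = 4 * y ^+ 2 - 4 * T * y + T ^+ 2); last by ring.
by rewrite trace_alpha_eq; ring.
Qed.

Lemma sqrt_disc_notin1 : sqrt_disc \notin 1%VS.
Proof. by apply: sqr_alg_nonsquare sqrt_disc_sqr => m; apply: disc2_nonsquare. Qed.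

Lemma dim_sqrt_disc : \dim <<1; sqrt_disc>>%VS = 2%N.
Proof.
have [//|_ deg2] := @adjoin_degree_quadratic _ 1 sqrt_disc 0 (t ^+ 2 + 4)%:~R (rpred0 _) (rpred_int _ _).
  by rewrite sqrt_disc_sqr mul0r add0r.
by rewrite dim_Fadjoin deg2 ?sqrt_disc_notin1 // dimv1.
Qed.

Lemma trace_alpha_in : y \in K.
Proof. by rewrite rpredB ?rpredV ?memv_adjoin. Qed.

Lemma sqrt_disc_in : sqrt_disc \in K.
Proof. by rewrite rpredB ?rpredM ?rpred_nat ?rpred_int ?trace_alpha_in. Qed.
End RootOfH.

(** * The Galois group *)

Lemma half_sum_in (L : fieldExtType rat) (E : {subfield L}) (a b : L) :
  a \in E -> b \in E -> (a + b) / 2 \in E.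
Proof. by move=> Ea Eb; rewrite rpred_div ?rpred_nat ?rpredD. Qed.

(** * The four roots of h, and the independence of alpha and gamma *)

Section Conjugates.
Variables (t : int) (L : fieldExtType rat) (alpha : L).
Hypothesis t_ge7 : 7 <= t.
Hypothesis h_alpha : root (map_poly (intr : int -> L) (h t)) alpha.
Local Notation T := (t%:~R : L).
Local Notation hL := (map_poly (intr : int -> L) (h t)).
Local Notation y := (trace_alpha alpha).
Local Notation y' := (T - y).

Lemma trace_alpha_mul : y * y' = -1.
Proof.
by rewrite mulrBr -expr2 (trace_alpha_eq h_alpha) mulrC opprD addNKr.
Qed.

Lemma h_factor : hL = ('X^2 - y%:P * 'X - 1) * ('X^2 - y'%:P * 'X - 1).
Proof.
have yy' : y%:P * y'%:P = -1 :> {poly L}.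
  by rewrite -polyCM trace_alpha_mul polyCN polyC1.
have yDy' : t%:~R = y%:P + y'%:P :> {poly L}.
  by rewrite -polyCD addrCA subrr addr0 rmorph_int.
rewrite map_h -!mul_polyC !rmorph_int rmorph_nat /= yDy'.
move: yy'; move: (y%:P) (y'%:P) => Y Y' YY'.
transitivity ('X^4 - (Y + Y') * 'X^3 + (Y * Y' - 2) * 'X^2 + (Y + Y') * 'X + 1); last by ring.
by rewrite YY'; ring.
Qed.

Lemma h_root_cases (r : L) :
  root hL r = (r ^+ 2 == y * r + 1) || (r ^+ 2 == y' * r + 1).
Proof. by rewrite h_factor rootM /root !hornerE -!addrA -!opprD !subr_eq0. Qed.

Lemma quadratic_roots (a r : L) : a != 0 ->
  (r ^+ 2 == trace_alpha a * r + 1) = (r \in [:: a; - a^-1]).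
Proof.
move=> a_nz; rewrite !inE -subr_eq0.
have -> : r ^+ 2 - (trace_alpha a * r + 1) = (r - a) * (r + a^-1).
  by rewrite /trace_alpha; field.
by rewrite mulf_eq0 subr_eq0 addr_eq0.
Qed.

(** Equality would mean alpha ^ 2 = -1, against the degree 4 of alpha. *)
Lemma alpha_neq_conj : alpha != - alpha^-1.
Proof.
have a_nz := alpha_neq0 h_alpha; apply/eqP => a_eq.
have a2 : alpha ^+ 2 = 0 * alpha + (-1).
  by rewrite mul0r add0r expr2 {2}a_eq mulrN divff.
have [le2 _] := adjoin_degree_quadratic (mem0v 1%AS) (rpredN1 1%AS) a2.
by have := dim_alpha t_ge7 h_alpha; rewrite dim_Fadjoin dimv1 muln1 => deg4; rewrite deg4 in le2.
Qed.

Variable gamma : L.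
Hypothesis gamma_eq : gamma ^+ 2 = y' * gamma + 1.

Lemma h_gamma : root hL gamma.
Proof. by rewrite h_root_cases gamma_eq eqxx orbT. Qed.

Lemma trace_gamma : trace_alpha gamma = y'.
Proof.
have g_nz := alpha_neq0 h_gamma.
apply: (mulIf g_nz); rewrite mulrBl mulVf // -expr2 gamma_eq.
by rewrite addrK.
Qed.

Lemma h_roots (r : L) :
  root hL r = (r \in [:: alpha; - alpha^-1; gamma; - gamma^-1]).
Proof.
have [a_nz g_nz] := (alpha_neq0 h_alpha, alpha_neq0 h_gamma).
rewrite h_root_cases quadratic_roots // -trace_gamma quadratic_roots //.
by rewrite !inE -!orbA.
Qed.

Local Notation F := <<1; sqrt_disc t alpha>>%AS.
Local Notation K := <<1; alpha>>%AS.

Lemma trace_alpha_inF : y \in F.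
Proof.
have -> : y = (sqrt_disc t alpha + T) / 2.
  by rewrite /sqrt_disc; field; apply: natr_fieldExt_neq0.
by apply: half_sum_in; [apply: memv_adjoin | apply: rpred_int].
Qed.

(** Here w = alpha + 1 / alpha and w' = gamma + 1 / gamma are square roots of y ^ 2 + 4 and y' ^ 2 +
    4 over F, and K lies in F(w). If gamma were in K, then w' or w' w would be in F. The first puts
    gamma, of degree 4, in the quadratic field F. *)
Lemma gamma_notin : gamma \notin K.
Proof.
have [a_nz g_nz] := (alpha_neq0 h_alpha, alpha_neq0 h_gamma).
have nz2 := natr_fieldExt_neq0 L 1.
pose w := 2 * alpha - y; pose w' := 2 * gamma - y'.
have w2 : w ^+ 2 = y ^+ 2 + 4 by rewrite /w /trace_alpha; field.
have w'2 : w' ^+ 2 = y' ^+ 2 + 4 by rewrite /w' -trace_gamma /trace_alpha; field.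
have Fy := trace_alpha_inF; have Fy' : y' \in F by rewrite rpredB ?rpred_int.
have [Fw2 Fw'2] : w ^+ 2 \in F /\ w' ^+ 2 \in F.
  by rewrite w2 w'2; split; apply: rpredD; rewrite ?rpred_nat // rpredX.
have sub_K : (K <= <<F; w>>)%VS.
  apply/FadjoinP; split; first exact: sub1v.
  rewrite [X in X \in _](_ : alpha = (w + y) / 2); last by rewrite /w; field.
  apply: half_sum_in; [exact: memv_adjoin | exact: (subvP_adjoin w Fy)].
apply/negP => Kg; have : w' \in <<F; w>>%VS.
  apply: rpredB; last exact: subvP_adjoin.
  by rewrite rpredM ?rpred_nat ?(subvP sub_K _ Kg).
case/(sqrt_in_quadratic Fw2 Fw'2) => [Fw'|].
  have : (<<1; gamma>> <= F)%VS.
    apply/FadjoinP; split; first exact: sub1v.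
    have -> : gamma = (w' + y') / 2 by rewrite /w'; field.
    exact: half_sum_in.
  by move/dimvS; rewrite (dim_alpha t_ge7 h_gamma) (dim_sqrt_disc t_ge7 h_alpha).
have ww'2 : (w' * w) ^+ 2 = (4 * t ^+ 2 + 25)%:~R.
  rewrite exprMn w2 w'2.
  transitivity ((y * y') ^+ 2 + 4 * ((y + y') ^+ 2 - 2 * (y * y')) + 16); first by ring.
  by rewrite trace_alpha_mul [y + _]addrC subrK; ring.
have s2 := sqrt_disc_sqr h_alpha.
(* In the second case the same dichotomy, now for F = Q(s) over Q, makes 4 t ^ 2 + 25 or its product
   with t ^ 2 + 4 a rational square. *)
move=> F_ww'; have := @sqrt_in_quadratic _ 1%AS _ _ _ _ F_ww'; rewrite s2 ww'2.
case; rewrite ?(rpred_int 1%AS) //; apply/negP.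
  by apply: sqr_alg_nonsquare ww'2 => m; apply: disc4_nonsquare.
apply: (@sqr_alg_nonsquare _ ((4 * t ^+ 2 + 25) * (t ^+ 2 + 4))).
  by move=> m; apply: disc_mul_nonsquare.
by rewrite exprMn ww'2 s2 -rmorphM.
Qed.
End Conjugates.

Lemma size_quadratic (R : nzRingType) (b : R) : size ('X^2 - b%:P * 'X - 1) = 3%N.
Proof.
rewrite -addrA -opprD size_polyDl ?size_polyXn // size_polyN.
rewrite (leq_ltn_trans (size_polyD _ _)) // gtn_max size_poly1 andbT.
by rewrite mul_polyC (leq_ltn_trans (size_scale_leq _ _)) ?size_polyX.
Qed.

Section GaloisGroup.
Variables (t : int) (L : splittingFieldType rat) (E : {subfield L}).
Hypothesis t_ge7 : 7 <= t.
Local Notation hL := (map_poly (intr : int -> L) (h t)).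
Hypothesis splitE : splittingFieldFor 1%VS hL E.

Lemma pchar_rat_ext : [pchar L] =i pred0.
Proof. by apply/pcharf0P => -[|n]; rewrite ?eqxx // (negPf (natr_fieldExt_neq0 L n)). Qed.

Lemma polyOver_h (K : {subfield L}) : hL \is a polyOver K.
Proof. by rewrite map_poly_intr_alg alg_polyOver. Qed.

Lemma galois_h : galois 1 E.
Proof.
rewrite /galois sub1v /=; apply/andP; split.
  by apply/separableP => x _; apply: pcharf0_separable; apply: pchar_rat_ext.
by apply/(splitting_normalField (sub1v E)); exists hL; rewrite ?polyOver_h.
Qed.

(** Any listed root serves as alpha. The conjugate quadratic divides the product of the linear
    factors and is not constant, so it has a root gamma in the list. The remaining roots are - 1 /
    alpha and - 1 / gamma. *)
Lemma splitting_roots : exists alpha gamma : L,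
  [/\ root hL alpha, gamma ^+ 2 = (t%:~R - trace_alpha alpha) * gamma + 1 &
      <<<<1; alpha>>; gamma>>%VS = E].
Proof.
have [rs h_rs defE] := splitE.
have mem_rs r : root hL r = (r \in rs) by rewrite (eqp_root h_rs) root_prod_XsubC.
case def_rs : rs => [|alpha rs'].
  have := eqp_size h_rs; rewrite def_rs big_nil size_poly1 map_poly_intr_alg size_map_poly.
  by rewrite size_rat_int_poly (proj1 (size_monic_h t)).
have h_alpha : root hL alpha by rewrite mem_rs def_rs mem_head.
set y' := t%:~R - trace_alpha alpha.
have [gamma gamma_rs] : exists2 gamma, gamma \in rs & root ('X^2 - y'%:P * 'X - 1) gamma.
  have : 'X^2 - y'%:P * 'X - 1 %| \prod_(r <- rs) ('X - r%:P).
    by rewrite -(eqp_dvdr _ h_rs) (h_factor h_alpha) dvdp_mulIr.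
  case/dvdp_prod_XsubC => m q_m.
  have := size_quadratic y'.
  rewrite (eqp_size q_m) size_prod_XsubC => -[sz_m].
  case def_m : (mask m rs) sz_m => [//|gamma s] _; exists gamma.
    by apply: (@mem_mask _ _ m); rewrite def_m mem_head.
  by rewrite (eqp_root q_m) root_prod_XsubC def_m mem_head.
rewrite /root !hornerE -addrA -opprD subr_eq0 => /eqP gamma_eq.
exists alpha, gamma; split=> //; rewrite -[RHS]defE; apply: subv_anti.
apply/andP; split.
  apply/(@FadjoinP _ _ <<1; alpha>>%AS gamma <<1 & rs>>%AS); split; last exact: seqv_sub_adjoin.
  by apply/FadjoinP; split; [apply: sub1v | rewrite seqv_sub_adjoin // def_rs mem_head].
apply/(@Fadjoin_seqP _ _ 1%AS rs <<<<1; alpha>>; gamma>>%AS); split; first exact: sub1v.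
have [Ka Kg] : alpha \in <<<<1; alpha>>; gamma>>%AS /\ gamma \in <<<<1; alpha>>; gamma>>%AS.
  by split; [apply: subvP_adjoin | ]; rewrite memv_adjoin.
move=> r; rewrite -mem_rs (h_roots h_alpha gamma_eq) !inE.
by case/or4P => /eqP->; rewrite ?rpredN ?rpredV.
Qed.

Section Automorphisms.
Variables alpha gamma : L.
Hypothesis h_alpha : root hL alpha.
Hypothesis gamma_eq : gamma ^+ 2 = (t%:~R - trace_alpha alpha) * gamma + 1.
Hypothesis defE : <<<<1; alpha>>; gamma>>%VS = E.
Local Notation K := <<1; alpha>>%AS.
Local Notation G := 'Gal(E / 1%VS)%g.

Let h_gamma := h_gamma h_alpha gamma_eq.

Lemma alpha_inE : alpha \in E.
Proof. by rewrite -defE subvP_adjoin ?memv_adjoin. Qed.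

Lemma gamma_inE : gamma \in E.
Proof. by rewrite -defE memv_adjoin. Qed.

Lemma sub_KE : (K <= E)%VS.
Proof. by apply/FadjoinP; split; [apply: sub1v | apply: alpha_inE]. Qed.

Lemma card_Gal : #|G| = 8%N.
Proof.
rewrite -(galois_dim galois_h) dimv1 divn1 -defE dim_Fadjoin (dim_alpha t_ge7 h_alpha).
have Ky' : t%:~R - trace_alpha alpha \in K by rewrite rpredB ?rpred_int ?trace_alpha_in.
have [_ ->//] := adjoin_degree_quadratic Ky' (rpred1 K) gamma_eq.
exact: (gamma_notin t_ge7 h_alpha gamma_eq).
Qed.

(** The fixed space of f g^-1 is a field containing the generators alpha and gamma of E. *)
Lemma gal_eq (f g : gal_of E) : f alpha = g alpha -> f gamma = g gamma -> f = g.
Proof.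
move=> fga fgg; suff : (f * g^-1 = 1)%g by move/eqP; rewrite -eq_mulgV1 => /eqP.
set u := (f * g^-1)%g.
have u_fix x : x \in E -> f x = g x -> x \in fixedSpace u.
  by move=> Ex fgx; apply/fixedSpaceP; rewrite galM // fgx -galM // mulgV gal_id.
have : (<<<<1; alpha>>; gamma>> <= fixedSpace_aspace u)%VS.
  apply/(@FadjoinP _ _ <<1; alpha>>%AS); split; last exact: u_fix gamma_inE fgg.
  by apply/FadjoinP; split; [apply: sub1v | apply: u_fix alpha_inE fga].
rewrite defE => /subvP fixE; apply/eqP/gal_eqP => x /fixE/fixedSpaceP->.
by rewrite gal_id.
Qed.

(** As gamma is not in K, its minimal polynomial over K is X ^ 2 - y' X - 1, whose other root is - 1
    / gamma. *)
Lemma gal_swap_gamma : exists2 k, k \in G & k alpha = alpha /\ k gamma = - gamma^-1.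
Proof.
have a_nz := alpha_neq0 h_alpha; have g_nz := alpha_neq0 h_gamma.
have gal_KE : normalField K E.
  by have /and3P[] := galoisS (introT andP (conj (sub1v K) sub_KE)) galois_h.
have [k k_G k_gamma] : exists2 k, k \in 'Gal(E / K)%g & k gamma = - gamma^-1.
  apply: normalField_root_minPoly => //; [exact: sub_KE | exact: gamma_inE |].
  pose y' := t%:~R - trace_alpha alpha; pose q := 'X^2 - y'%:P * 'X - 1.
  have q_gamma : root q gamma by rewrite /root !hornerE gamma_eq -addrA -opprD subrr.
  have q_gammaV : root q (- gamma^-1).
    rewrite /root !hornerE -addrA -opprD subr_eq0 /y' -(trace_gamma h_alpha gamma_eq) quadratic_roots //.
    by rewrite !inE eqxx orbT.
  have Kq : q \is a polyOver K.
    rewrite !rpredB ?rpredM ?polyOverXn ?polyOverX ?polyOverC ?rpred1 //.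
    by rewrite rpredB ?rpred_int ?trace_alpha_in.
  have /dvdp_size_eqp := minPoly_dvdp Kq q_gamma.
  rewrite size_quadratic size_minPoly.
  have Ky' : y' \in K by rewrite rpredB ?rpred_int ?trace_alpha_in.
  have [_ ->] := adjoin_degree_quadratic Ky' (rpred1 K) gamma_eq; last first.
    exact: (gamma_notin t_ge7 h_alpha gamma_eq).
  by rewrite eqxx => /esym/eqp_root->.
have /fintype.subsetP subG := @galS _ _ 1%AS K E (sub1v _).
exists k; first exact: subG.
by split=> //; rewrite (fixed_gal sub_KE k_G) ?memv_adjoin.
Qed.

(** Irreducibility of h gives some g sending alpha to gamma. It sends y to y', hence y' to y, and
    gamma to alpha or - 1 / alpha. *)
Lemma gal_swap : exists2 g, g \in G & g alpha = gamma /\ g gamma = alpha.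
Proof.
have a_nz := alpha_neq0 h_alpha; have g_nz := alpha_neq0 h_gamma.
have /and3P[_ _ normE] := galois_h.
have [g g_G g_alpha] : exists2 g, g \in G & g alpha = gamma.
  apply: normalField_root_minPoly => //; [exact: sub1v | exact: alpha_inE |].
  have /polyOver1P[m m_eq] := minPolyOver 1 alpha; rewrite m_eq.
  apply: (@conj_root _ (map_poly intr (h t)) _ alpha).
  - exact/irreducible_h/(t_neq0 t_ge7).
  - by rewrite -map_poly_intr_alg.
  - by rewrite -map_poly_intr_alg.
  by rewrite -m_eq root_minPoly.
have g_y : g (trace_alpha alpha) = t%:~R - trace_alpha alpha.
  by rewrite /trace_alpha rmorphB fmorphV /= g_alpha -/(trace_alpha gamma) (trace_gamma h_alpha gamma_eq).
have : g gamma \in [:: alpha; - alpha^-1].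
  rewrite -quadratic_roots // -rmorphXn gamma_eq rmorphD rmorphM rmorphB rmorph_int rmorph1 /= g_y.
  by rewrite subKr.
have [k k_G [k_alpha k_gamma]] := gal_swap_gamma.
rewrite !inE => /orP[] /eqP g_gamma; first by exists g.
(* In the second case g is corrected by k, which acts first in this product. *)
exists (k * g)%g; first by rewrite groupM.
rewrite !galM ?alpha_inE ?gamma_inE // k_alpha k_gamma g_alpha; split=> //.
by rewrite rmorphN fmorphV /= g_gamma invrN opprK invrK.
Qed.

Lemma Gal_isog_D8 : G \isog 'D_8.
Proof.
have a_nz := alpha_neq0 h_alpha; have g_nz := alpha_neq0 h_gamma.
have [k k_G [k_alpha k_gamma]] := gal_swap_gamma.
have [g g_G [g_alpha g_gamma]] := gal_swap.
have galE := (galM, alpha_inE, gamma_inE, gal_id).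
have K'g := gamma_notin t_ge7 h_alpha gamma_eq.
have a_g : gamma != alpha by apply: contraNneq K'g => ->; rewrite memv_adjoin.
have a_gV : - gamma^-1 != alpha.
  apply: contraNneq K'g => gV; have -> : gamma = (- alpha)^-1 by rewrite -gV opprK invrK.
  by rewrite rpredV rpredN memv_adjoin.
have aV := alpha_neq_conj t_ge7 h_alpha; have gV := alpha_neq_conj t_ge7 h_gamma.
have conjV (f : gal_of E) x : f (- x^-1) = - (f x)^-1 by rewrite rmorphN fmorphV.
have k1 : k != 1%g by apply: contra_neq gV => k1; rewrite -k_gamma k1 gal_id.
have g1 : g != 1%g by apply: contra_neq a_g => g1; rewrite -g_alpha g1 gal_id.
have neq_kg : k != g by apply: contra_neq a_g => kg; rewrite -g_alpha -kg k_alpha.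
have kk : (k * k = 1)%g.
  by apply: gal_eq; rewrite !galE ?k_alpha ?k_gamma // conjV k_gamma invrN opprK invrK.
have gg : (g * g = 1)%g by apply: gal_eq; rewrite !galE ?g_alpha ?g_gamma.
have ok : #[k]%g = 2%N by apply: nt_prime_order => //; rewrite expgS expg1.
have og : #[g]%g = 2%N by apply: nt_prime_order => //; rewrite expgS expg1.
pose H := <<[set k; g]>>%G.
have : H \isog 'D_#|H| := involutions_gen_dihedral ok og neq_kg.
suff -> : H = G :> {set _} by rewrite card_Gal.
have sHG : H \subset G by rewrite gen_subG finset.subUset !finset.sub1set k_G.
apply/eqP; rewrite eqEcard sHG card_Gal /=.
have Hk : k \in H by rewrite mem_gen ?finset.set21.
have Hg : g \in H by rewrite mem_gen ?finset.set22.
(* Five distinct elements suffice, since the order of [H] divides 8. They are told apart by their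
   values at alpha and gamma. *)
have : (4 < #|H|)%N.
  pose s := [:: 1; k; g; k * g; g * k]%g.
  have s_uniq : uniq s.
    have ne (f f' : gal_of E) x : f x != f' x -> f != f' by apply: contra_neq => ->.
    have kg_alpha : (k * g)%g alpha = gamma by rewrite galM ?alpha_inE // k_alpha.
    have kg_gamma : (k * g)%g gamma = - alpha^-1 by rewrite galM ?gamma_inE // k_gamma conjV g_gamma.
    have gk_alpha : (g * k)%g alpha = - gamma^-1 by rewrite galM ?alpha_inE // g_alpha.
    have n1 : 1%g != (k * g)%g by apply: (ne _ _ alpha); rewrite gal_id kg_alpha eq_sym.
    have n2 : 1%g != (g * k)%g by apply: (ne _ _ alpha); rewrite gal_id gk_alpha eq_sym.
    have n3 : k != (k * g)%g by apply: (ne _ _ alpha); rewrite k_alpha kg_alpha eq_sym.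
    have n4 : k != (g * k)%g by apply: (ne _ _ alpha); rewrite k_alpha gk_alpha eq_sym.
    have n5 : g != (k * g)%g by apply: (ne _ _ gamma); rewrite g_gamma kg_gamma.
    have n6 : g != (g * k)%g by apply: (ne _ _ alpha); rewrite g_alpha gk_alpha.
    have n7 : (k * g)%g != (g * k)%g by apply: (ne _ _ alpha); rewrite kg_alpha gk_alpha.
    rewrite /= !inE !negb_or ![1%g == _]eq_sym k1 g1 neq_kg.
    by rewrite ![_ == 1%g]eq_sym n1 n2 n3 n4 n5 n6 n7.
  rewrite cardE; apply: (@uniq_leq_size _ s (enum H) s_uniq) => x.
  rewrite mem_enum /s in_cons in_cons in_cons in_cons mem_seq1.
  by case/or4P => [||| /orP[]] /eqP->; rewrite ?groupM ?group1.
by have := cardSg sHG; rewrite card_Gal dvdn_divisors // !inE => /or4P[] /eqP->.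
Qed.
End Automorphisms.

Lemma Gal_h : 'Gal(E / 1%VS)%g \isog 'D_8.
Proof.
have [alpha [gamma [h_alpha gamma_eq defE]]] := splitting_roots.
exact: Gal_isog_D8 h_alpha gamma_eq defE.
Qed.
End GaloisGroup.

(** * The power basis *)

Lemma trace_alpha_poly (t : int) (L : fieldExtType rat) (r : L) :
  root (map_poly (intr : int -> L) (h t)) r ->
  trace_alpha r = r ^+ 3 - t%:~R * r ^+ 2 - 2 * r + t%:~R.
Proof.
move=> h_r; have r_nz := alpha_neq0 h_r; apply/esym/eqP.
rewrite -subr_eq0 -[X in _ == X](mul0r r^-1) -(alpha_eq h_r) /trace_alpha.
by apply/eqP; field.
Qed.

Lemma trace_alpha_mulr (t : int) (L : fieldExtType rat) (r : L) :
  root (map_poly (intr : int -> L) (h t)) r -> trace_alpha r * r = r ^+ 2 - 1.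
Proof. by move=> h_r; have r_nz := alpha_neq0 h_r; rewrite mulrBl mulVf. Qed.

Section PowerBasis.
Variables (t : int) (L : fieldExtType rat) (alpha : L).
Hypothesis t_ge7 : 7 <= t.
Hypothesis h_alpha : root (map_poly (intr : int -> L) (h t)) alpha.
Variables n2 n4 : nat.
Hypothesis n2_def : n2%:Z = t ^+ 2 + 4.
Hypothesis n4_def : n4%:Z = 4 * t ^+ 2 + 25.
Hypothesis n2_sqf : square_free n2.
Hypothesis n4_sqf : square_free n4.
Local Notation T := (t%:~R : L).
Local Notation y := (trace_alpha alpha).
Local Notation K := <<1; alpha>>%AS.
Local Notation integral := (integralOver (intr : int -> L)).
Local Notation c := (in_alg L).
Local Notation tau := (t%:~R : rat).

Let tauE : c tau = T. Proof. by rewrite rmorph_int. Qed.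
Let tauA : tau *: (1 : L) = T. Proof. exact: tauE. Qed.
Let n2E : n2%:R = tau ^+ 2 + 4.
Proof. by rewrite -[LHS]/(n2%:Z%:~R) n2_def; ring. Qed.
Let n4E : n4%:R = 4 * tau ^+ 2 + 25.
Proof. by rewrite -[LHS]/(n4%:Z%:~R) n4_def; ring. Qed.

Lemma integral_trace_alpha : integral y.
Proof.
exists ('X^2 - t%:P * 'X - 1).
  by rewrite monicE lead_coefE size_quadratic !coefB coefXn coefCM coefX coef1 mulr0 !subr0.
rewrite /root !rmorphB /= map_polyXn rmorphM /= map_polyX map_polyC rmorph1 !hornerE /=.
by rewrite (trace_alpha_eq h_alpha) -addrA -opprD subrr.
Qed.

(** Both y and t - y are roots of X ^ 2 - t X - 1, which is irreducible because its discriminant t ^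
    2 + 4 is not a square. *)
Lemma conj_trace_integral (a b : rat) :
  integral (c a + c b * y) -> integral (c a + c b * (T - y)).
Proof.
pose p : {poly rat} := 'X^2 - tau%:P * 'X - 1.
have p_irr : irreducible_poly p.
  apply: cubic_irreducible => [|r]; first by rewrite size_quadratic.
  apply/negP; rewrite /root !hornerE -addrA -opprD subr_eq0 => /eqP r2.
  have : (2 * r - tau) ^+ 2 = (t ^+ 2 + 4)%:~R.
    transitivity (4 * (r * r) - 4 * tau * r + tau ^+ 2); first by ring.
    by rewrite -expr2 r2; ring.
  by case/sqr_rat_int => m; apply: disc2_nonsquare.
have p_map z : (map_poly c p).[z] = z ^+ 2 - (T * z + 1).
  rewrite /p !rmorphB /= map_polyXn rmorphM /= map_polyX map_polyC rmorph1 /= tauA.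
  by rewrite !hornerE -addrA -opprD.
have p_y : root (map_poly c p) y by rewrite /root p_map (trace_alpha_eq h_alpha) subrr.
have p_y' : root (map_poly c p) (T - y).
  rewrite /root p_map; apply/eqP; transitivity (y ^+ 2 - (T * y + 1)); first by ring.
  by rewrite (trace_alpha_eq h_alpha) subrr.
have q_map z : (map_poly c (a%:P + b%:P * 'X)).[z] = c a + c b * z.
  by rewrite rmorphD rmorphM /= map_polyX !map_polyC /= !hornerE.
by rewrite -!q_map; apply: conj_integral p_irr p_y p_y'.
Qed.

(** The integers of Q(s) are Z[y]. The trace S and the norm N of a + b y are integers with S ^ 2 - 4
    N = (t ^ 2 + 4) b ^ 2, so b is an integer by square-freeness; then a is rational and
    integral. *)
Lemma integral_quadratic (a b : rat) :
  integral (c a + c b * y) -> a \is a Num.int /\ b \is a Num.int.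
Proof.
move=> z_int; have z'_int := conj_trace_integral z_int.
have y_int := integral_trace_alpha.
have tr_int : 2 * a + b * tau \is a Num.int.
  apply: (@integral_rat L); have := integralD z_int z'_int.
  by congr integralOver; rewrite -tauE; ring.
have norm_int : a ^+ 2 + a * b * tau - b ^+ 2 \is a Num.int.
  apply: (@integral_rat L); have := integralM z_int z'_int.
  congr integralOver; transitivity (c a ^+ 2 + c a * c b * T + c b ^+ 2 * (y * (T - y))); first by ring.
  by rewrite (trace_alpha_mul h_alpha) -tauE; ring.
have b_int : b \is a Num.int.
  apply: (square_free_rat_int n2_sqf); rewrite n2E.
  rewrite (_ : _ * _ = (2 * a + b * tau) ^+ 2 - 4 * (a ^+ 2 + a * b * tau - b ^+ 2)); last by ring.
  by rewrite rpredB ?rpredX ?rpredM ?rpred_nat.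
split=> //; apply: (@integral_rat L); case/intrP: b_int => m b_m.
have := integralB z_int (integralM (integral_int L m) y_int).
by rewrite b_m rmorph_int addrK.
Qed.

(* [val r] is the image of [val alpha] under the embedding [alpha -> r], since [trace_alpha r]
   is an integer polynomial in [r]. *)
Lemma conj_alpha_integral (u0 u1 v0 v1 : rat) (r : L)
    (val := fun r => c u0 + c u1 * trace_alpha r + (c v0 + c v1 * trace_alpha r) * r) :
  root (map_poly (intr : int -> L) (h t)) r -> integral (val alpha) -> integral (val r).
Proof.
move=> h_r; pose Y : {poly rat} := 'X^3 - tau *: 'X^2 - 2 *: 'X + tau%:P.
pose q := u0%:P + u1%:P * Y + (v0%:P + v1%:P * Y) * 'X.
have Y_map z : root (map_poly (intr : int -> L) (h t)) z -> (map_poly c Y).[z] = trace_alpha z.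
  move=> h_z; rewrite (trace_alpha_poly h_z) /Y rmorphD !rmorphB /= !map_polyZ.
  by rewrite !map_polyXn map_polyX map_polyC /= tauA !hornerE scaler_nat.
have q_map z : root (map_poly (intr : int -> L) (h t)) z -> (map_poly c q).[z] = val z.
  move=> h_z; rewrite /q /val -!Y_map // !(rmorphD, rmorphM) /= map_polyX !map_polyC /=.
  by rewrite !hornerE.
rewrite -!q_map //; apply: (@conj_integral _ (map_poly intr (h t))).
- exact/irreducible_h/(t_neq0 t_ge7).
- by rewrite -map_poly_intr_alg.
- by rewrite -map_poly_intr_alg.
Qed.

Lemma in_K_coordinates (x : L) : x \in K -> exists u0 u1 v0 v1 : rat,
  x = c u0 + c u1 * y + (c v0 + c v1 * y) * alpha.
Proof.
move=> Kx.
have deg4 : adjoin_degree 1%AS alpha = 4%N.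
  by have := dim_alpha t_ge7 h_alpha; rewrite dim_Fadjoin dimv1 muln1.
rewrite -(Fadjoin_poly_eq Kx).
have := size_Fadjoin_poly 1%AS alpha x; rewrite deg4 => sz.
have /polyOverP Qp := Fadjoin_polyOver 1%AS alpha x.
rewrite (horner_coef_wide _ sz) !big_ord_recl big_ord0 /= /bump /=.
have Qc i : exists r, (Fadjoin_poly 1%AS alpha x)`_i = c r by have /vlineP[r] := Qp i; exists r.
have [[c0 ->] [c1 ->]] := (Qc 0%N, Qc 1%N); have [[c2 ->] [c3 ->]] := (Qc 2%N, Qc 3%N).
(* Read off from alpha ^ 2 = 1 + y alpha and alpha ^ 3 = y + 2 alpha + t y alpha. *)
exists (c0 + c2), c3, (c1 + 2 * c3), (c2 + tau * c3).
have -> : (c0 + c2)%:A = c c0 + c c2 :> L by rewrite -[LHS]/(c _); ring.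
have -> : (c1 + 2 * c3)%:A = c c1 + 2 * c c3 :> L by rewrite -[LHS]/(c _); ring.
have -> : (c2 + tau * c3)%:A = c c2 + T * c c3 :> L by rewrite -[LHS]/(c _) -tauE; ring.
rewrite -[c3%:A]/(c c3).
rewrite addr0 expr0 mulr1 expr1.
move: (c c0) (c c1) (c c2) (c c3) => d0 d1 d2 d3.
transitivity (d0 + d2 + d3 * y + (d1 + 2 * d3) * alpha + (d2 + T * d3) * (y * alpha)); last by ring.
by rewrite (trace_alpha_mulr h_alpha) (trace_alpha_poly h_alpha); ring.
Qed.

Lemma integral_coordinates (u0 u1 v0 v1 : rat) :
  integral (c u0 + c u1 * y + (c v0 + c v1 * y) * alpha) ->
  [/\ u0 \is a Num.int, u1 \is a Num.int, v0 \is a Num.int & v1 \is a Num.int].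
Proof.
have a_nz := alpha_neq0 h_alpha; have y2 := trace_alpha_eq h_alpha.
set x := (X in integral X) => x_int; pose b := c v0 + c v1 * y.
have h_a' : root (map_poly (intr : int -> L) (h t)) (- alpha^-1).
  by rewrite (h_root_cases h_alpha) quadratic_roots // !inE eqxx orbT.
have y_a' : trace_alpha (- alpha^-1) = y.
  by rewrite /trace_alpha invrN invrK opprK addrC.
have := conj_alpha_integral h_a' x_int; rewrite y_a' -/b; set x' := (X in integral X) => x'_int.
(* B0 + B1 y is b ^ 2, and E0 + E1 y is b ^ 2 (y ^ 2 + 4) = b ^ 2 (5 + t y), the square of x -
   x'. *)
pose B0 := v0 ^+ 2 + v1 ^+ 2; pose B1 := 2 * v0 * v1 + tau * v1 ^+ 2.
pose E0 := 5 * B0 + tau * B1; pose E1 := tau * B0 + (5 + tau ^+ 2) * B1.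
have [E0_int E1_int] : E0 \is a Num.int /\ E1 \is a Num.int.
  apply: integral_quadratic.
  have dx := integralB x_int x'_int; have := integralM dx dx; congr integralOver.
  have -> : x - x' = b * (alpha + alpha^-1) by rewrite /x /x' -/b; ring.
  have d2 : (alpha + alpha^-1) ^+ 2 = T * y + 5.
    by rewrite -[5]/(1 + 4)%:R natrD addrA -y2 /trace_alpha; field.
  have b2 : b ^+ 2 = c B0 + c B1 * y.
    transitivity (c v0 ^+ 2 + 2 * c v0 * c v1 * y + c v1 ^+ 2 * y ^+ 2); first by rewrite /b; ring.
    by rewrite y2 /B0 /B1 -tauE; ring.
  rewrite -expr2 exprMn d2 b2.
  transitivity (c B0 * 5 + (c B0 * T + c B1 * 5) * y + c B1 * T * y ^+ 2); first by ring.
  by rewrite y2 /E0 /E1 -tauE; ring.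
have [[e0 E0_e] [e1 E1_e]] := (intrP E0_int, intrP E1_int).
(* [N] and [S] are the norm and the trace of b over Q; 5 + t y has norm 4 t ^ 2 + 25. *)
pose N := v0 ^+ 2 + v0 * v1 * tau - v1 ^+ 2; pose S := 2 * v0 + v1 * tau.
have /intrP[n n_def] : N \is a Num.int.
  apply: (square_free_rat_int n4_sqf).
  have -> : n4%:R * N ^+ 2 = (e0 ^+ 2 + e0 * e1 * t - e1 ^+ 2)%:~R; last exact: intr_int.
  transitivity (E0 ^+ 2 + E0 * E1 * tau - E1 ^+ 2); last by rewrite E0_e E1_e; ring.
  by rewrite n4E /N /E0 /E1 /B0 /B1; ring.
have /intrP[s s_def] : S \is a Num.int.
  apply: (square_free_rat_int n4_sqf).
  (* This is S ^ 2 = Tr(b ^ 2) + 2 N multiplied by 4 t ^ 2 + 25, where (4 t ^ 2 + 25) b ^ 2 is E0 +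
     E1 y times the conjugate 5 + t ^ 2 - t y. *)
  have -> : n4%:R * S ^+ 2 = (2 * ((5 + t ^+ 2) * e0 - t * e1) + t * (5 * e1 - t * e0)
      + 2 * (4 * t ^+ 2 + 25) * n)%:~R; last exact: intr_int.
  transitivity (2 * ((5 + tau ^+ 2) * E0 - tau * E1) + tau * (5 * E1 - tau * E0)
      + 2 * (4 * tau ^+ 2 + 25) * N); last by rewrite E0_e E1_e n_def; ring.
  by rewrite n4E /S /N /E0 /E1 /B0 /B1; ring.
have /intrP[w w_def] : v1 \is a Num.int.
  apply: (square_free_rat_int n2_sqf).
  have -> : n2%:R * v1 ^+ 2 = (s ^+ 2 - 4 * n)%:~R; last exact: intr_int.
  transitivity (S ^+ 2 - 4 * N); last by rewrite s_def n_def; ring.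
  by rewrite n2E /S /N; ring.
have /intrP[u u_def] : v0 \is a Num.int.
  (* So far only 2 v0 is known to be an integer m; the norm equation multiplied by 4 shows that m ^
     2, hence m, is even. *)
  have m_def : 2 * v0 = (s - w * t)%:~R.
    by transitivity (S - v1 * tau); [rewrite /S addrK | rewrite s_def w_def; ring].
  set m := s - w * t in m_def.
  have m2 : m ^+ 2 + 2 * m * (w * t) = 4 * (n + w ^+ 2).
    apply: (@intr_inj rat); transitivity (m%:~R * (m%:~R + 2 * (w%:~R * tau)) : rat); first by ring.
    rewrite -m_def -w_def; transitivity (4 * (N + v1 ^+ 2)); first by rewrite /N; ring.
    by rewrite n_def w_def; ring.
  have [j m_j] : exists j : int, m = 2 * j.
    have [j [m_j|m_j]] : exists j : int, m = 2 * j \/ m = 2 * j + 1 by exists (m %/ 2)%Z; lia.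
      by exists j.
    by move: m2; rewrite m_j; move: (w * t) (n + _) => p q; nia.
  suff -> : v0 = j%:~R by rewrite intr_int.
  by apply: (mulfI (_ : 2 != 0)) => //; rewrite m_def m_j rmorphM.
have y_int : integral y by apply: integral_trace_alpha.
have alpha_int : integral alpha by exists (h t) => //; case: (size_monic_h t).
have [|u0_int u1_int] := @integral_quadratic u0 u1.
  have := integralB x_int
    (integralM (integralD (integral_int L u) (integralM (integral_int L w) y_int)) alpha_int).
  by congr integralOver; rewrite /x u_def w_def !rmorph_int addrK.
by rewrite u0_int u1_int u_def w_def !intr_int.
Qed.

Lemma monogenic_h : is_monogenic K.
Proof.
exists alpha; first exact: memv_adjoin.
suff main x : in_ring_of_integers K x <->
    exists a : 'I_4 -> int, x = \sum_(i < 4) (a i)%:~R * alpha ^+ i.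
  by rewrite (dim_alpha t_ge7 h_alpha).
have sum4 (f : nat -> int) : \sum_(i < 4) (f i)%:~R * alpha ^+ i =
    (f 0)%:~R + (f 1)%:~R * alpha + (f 2)%:~R * alpha ^+ 2 + (f 3)%:~R * alpha ^+ 3.
  by rewrite !big_ord_recl big_ord0 addr0 expr0 mulr1 !addrA.
split=> [[Kx x_int]|[a ->]]; last first.
  rewrite (eq_bigr (fun i : 'I_4 => (a (inord i))%:~R * alpha ^+ i)).
    2: by move=> i; rewrite inord_val.
  by rewrite (sum4 (fun i => a (inord i))); apply/ring_cubic/(ring_alpha h_alpha).
have [u0 [u1 [v0 [v1 x_eq]]]] := in_K_coordinates Kx; rewrite x_eq in x_int *.
have [/intrP[m0 ->] /intrP[m1 ->] /intrP[n0 ->] /intrP[n1 ->]] := integral_coordinates x_int.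
(* The inverse of the base change from powers of alpha to 1, y, alpha, y alpha; it has integer
   entries too. *)
pose s := [:: m0 + t * m1 - n1; n0 - 2 * m1; n1 - t * m1; m1].
exists (fun i => s`_i); rewrite (sum4 (fun i => s`_i)) /=.
have intE m : (m%:~R : rat)%:A = m%:~R :> L := rmorph_int c m.
rewrite !intE.
transitivity (m0%:~R + m1%:~R * y + n0%:~R * alpha + n1%:~R * (y * alpha) : L); first by ring.
by rewrite (trace_alpha_mulr h_alpha) (trace_alpha_poly h_alpha); ring.
Qed.
End PowerBasis.

Theorem theorem3p2 :
  (forall t : int, 7 <= t ->
    [/\ irreducible_poly (map_poly (intr : int -> rat) (h t)),
        forall (L : fieldExtType rat) (alpha : L),
          root (map_poly (intr : int -> L) (h t)) alpha ->
          [/\ is_exceptional_unit <<1; alpha>>%AS alpha,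
              is_int_unit <<1; alpha>>%AS (1 + alpha),
              is_exceptional_unit <<1; alpha>>%AS (alpha ^+ 2),
              \dim <<1; alpha>>%VS = 4%N &
              exists s : L,
                [/\ s ^+ 2 = (t ^+ 2 + 4)%:~R,
                    \dim <<1; s>>%VS = 2%N &
                    (<<1; s>> <= <<1; alpha>>)%VS]]
      & forall (L : splittingFieldType rat) (E : {subfield L}),
          splittingFieldFor 1%VS (map_poly (intr : int -> L) (h t)) E ->
          ('Gal(E / 1%VS) \isog 'D_8)%g]) /\
  infinite_set
    [set t : int | 7 <= t /\
       forall (L : fieldExtType rat) (alpha : L),
         root (map_poly (intr : int -> L) (h t)) alpha ->
         is_monogenic <<1; alpha>>%AS]%classic.
Proof.
split=> [t t_ge7|].
  split; first exact/irreducible_h/(t_neq0 t_ge7).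
    move=> L alpha h_alpha; split.
    - exact: exceptional_alpha h_alpha.
    - exact: unit_alpha_add1 h_alpha.
    - exact: exceptional_alpha_sqr h_alpha.
    - exact: dim_alpha t_ge7 h_alpha.
    exists (sqrt_disc t alpha); split.
    - exact: sqrt_disc_sqr h_alpha.
    - exact: dim_sqrt_disc t_ge7 h_alpha.
    by apply/FadjoinP; split; [apply: sub1v | apply: sqrt_disc_in].
  by move=> L E; apply: Gal_h.
case/finite_seqP => s s_def.
(* Were the set a finite list, the sum of absolute values would bound all its members; a good k
   beyond that sum yields a member 10 k + 7 that is too large. *)
have [k le_k [sqf2 sqf4]] := square_free_values (\sum_(x <- s) `|x|)%N.
have : (10 * k + 7)%N%:Z \in s.
  suff : [set` s]%classic (10 * k + 7)%N%:Z by [].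
  rewrite -s_def /=; split=> [|L alpha h_alpha]; first by lia.
  by apply: (monogenic_h _ h_alpha _ _ sqf2 sqf4); lia.
move=> t_s; have : (`|(10 * k + 7)%N%:Z| <= \sum_(x <- s) `|x|)%N.
  by rewrite (big_rem _ t_s) leq_addr.
by lia.
Qed.
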